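(* Let $(\omega_1,\omega_2,\omega_3)$ be a triplet of $2$-forms and $(\pi_1,\pi_2,\pi_3)$ a triplet of bivectors on a Lie algebroid $(A,\mu)$, and let $$\mathcal{S}_i=\begin{pmatrix}0&-\pi_i^{\sharp}\\ \omega_i^{\flat}&0\end{pmatrix}:A\oplus A^*\to A\oplus A^*,\qquad i=1,2,3 .$$ The following assertions are equivalent: (i) $(\omega_1,\omega_2,\omega_3)$ is a hypersymplectic structure with torsion on the Lie algebroid $(A,\mu)$ and $\pi_i$ is the inverse of $\omega_i$, $i=1,2,3$; (ii) $(\mathcal{S}_1,\mathcal{S}_2,\mathcal{S}_3)$ is a hypersymplectic structure on the pre-Courant algebroid $(A\oplus A^*,\mu+\psi)$, for some $\psi\in\Gamma(\wedge^3A)$.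
   Context: $A\to M$ is a real vector bundle. For $\omega\in\Gamma(\wedge^2A^* )$ and $\pi\in\Gamma(\wedge^2A)$, $\omega^\flat:A\to A^*$, $\langle\omega^\flat X,Y\rangle=\omega(X,Y)$, and $\pi^\sharp:A^*\to A$, $\langle\beta,\pi^\sharp\alpha\rangle=\pi(\alpha,\beta)$; $\pi$ is the inverse of $\omega$ if $\pi^\sharp\circ\omega^\flat=\mathrm{id}_A$. Indices are in $\mathbb{Z}_3=\{1,2,3\}$. Hypersymplectic with torsion: a triplet $(\omega_1,\omega_2,\omega_3)$ of non-degenerate $2$-forms on $(A,\mu)$ with inverses $\pi_1,\pi_2,\pi_3\in\Gamma(\wedge^2A)$ is a hypersymplectic structure with torsion on $(A,\mu)$ if the transition morphisms $N_i:=\pi_{i-1}^\sharp\circ\omega_{i+1}^\flat:A\to A$ satisfy $N_i^2=-\mathrm{id}_A$, $i=1,2,3$, and $N_1\mathrm{d}\omega_1=N_2\mathrm{d}\omega_2=N_3\mathrm{d}\omega_3$, where $N_i\mathrm{d}\omega_i(X,Y,Z)=\mathrm{d}\omega_i(N_iX,N_iY,N_iZ)$ and $\mathrm{d}$ is the differential of the Lie algebroid $(A,\mu)$. Big bracket: $\mathcal{F}=C^\infty(T^*[2]A[1])$ with its canonical Poisson bracket $\{\cdot,\cdot\}$ (the big bracket), given in local coordinates $x_i,\xi_a$ on $A[1]$ and conjugate $p^i,\theta^a$ by $\{p^i,x_i\}=\{\theta^a,\xi_a\}=1$, other brackets zero. Bidegrees: $x_i:(0,0)$, $\xi_a:(0,1)$,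 $p^i:(1,1)$, $\theta^a:(1,0)$; $\mathcal{F}^{k,l}$ is the space of functions of bidegree $(k,l)$, $\mathcal{F}^{k,0}=\Gamma(\wedge^kA)$, $\mathcal{F}^{0,l}=\Gamma(\wedge^lA^* )$. A Lie algebroid structure on $A$ is an element $\mu\in\mathcal{F}^{1,2}$ with $\{\mu,\mu\}=0$ (bracket $\{\{X,\mu\},Y\}$, anchor $\rho(X)\cdot f=\{\{X,\mu\},f\}$). $A\oplus A^*$ carries $\langle X+\alpha,Y+\beta\rangle=\alpha(Y)+\beta(X)$. Any $\Theta$ of total degree $3$ in $\mathcal{F}$ defines a pre-Courant structure on $A\oplus A^*$, with anchor $\rho(e)\cdot f=\{\{e,\Theta\},f\}$ and Dorfman bracket $[e,e']=\{\{e,\Theta\},e'\}$, $e,e'\in\Gamma(A\oplus A^* )$, $f\in C^\infty(M)$ (pre-Courant means $\rho(e)\cdot\langle e',e''\rangle=\langle[e,e'],e''\rangle+\langle e',[e,e'']\rangle=\langle e,[e',e'']+[e'',e']\rangle$). For a pre-Courant structure $\Theta=(\rho,[\cdot,\cdot])$ on $E$ and a bundle endomorphism $\mathcal{I}$ of $E$, $\Theta_{\mathcal{I}}=(\rho\circ\mathcal{I},[\cdot,\cdot]_{\mathcal{I}})$ with $[e,e']_{\mathcal{I}}=[\mathcal{I}e,e']+[e,\mathcal{I}e']-\mathcal{I}[e,e']$, and $\Theta_{\mathcal{I},\mathcal{J}}=(\Theta_{\mathcal{I}})_{\mathcal{J}}$. A hypersymplectic structure on $(E,\Theta)$ is a triplet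 $(\mathcal{S}_1,\mathcal{S}_2,\mathcal{S}_3)$ of endomorphisms of $E$, skew-symmetric with respect to $\langle\cdot,\cdot\rangle$, such that $\mathcal{S}_i^2=-\mathrm{id}_E$, $\mathcal{S}_i\mathcal{S}_j=-\mathcal{S}_j\mathcal{S}_i$ for $i\neq j$, and $\Theta_{\mathcal{S}_i,\mathcal{S}_i}=-\Theta$, for $i,j\in\{1,2,3\}$. *)

(* Defs.v *)
From HB Require Import structures.
From mathcomp Require Import all_boot all_order all_algebra.
From mathcomp Require Import all_classical all_reals all_analysis.
From mathcomp Require Import ring.
Import Order.TTheory GRing.Theory Num.Theory.
Import numFieldNormedType.Exports.

Set Implicit Arguments.
Unset Strict Implicit.
Unset Printing Implicit Defensive.

Local Open Scope classical_set_scope.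
Local Open Scope ring_scope.

Section smooth_rn.
Variables (R : realType) (n : nat).
Implicit Types (U : set 'rV[R]_n) (f g : 'rV[R]_n -> R) (k : nat).

(* Meaningful for open U only, where it depends on the restriction of f to U. *)
Fixpoint Ck k U f : Prop :=
  (forall x, U x -> {for x, continuous f}) /\
  match k with
  | 0%N => True
  | k'.+1 => forall i : 'I_n,
      (forall x, U x -> derivable f x (delta_mx 0 i)) /\
      Ck k' U ('D_(delta_mx 0 i) f)
  end.

Definition smooth_on U f := forall k, Ck k U f.

Lemma Ck_cont k U f x : Ck k U f -> U x -> {for x, continuous f}.
Proof. by case: k => [|k] [+ _]; apply. Qed.

Lemma CkW k U f : Ck k.+1 U f -> Ck k U f.
Proof.
elim: k f => [|k IH] f [cf Df]; first by split.
by split=> // i; have [? ?] := Df i; split=> //; apply: IH.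
Qed.

Lemma open_near_eq U f g x : open U -> (forall y, U y -> f y = g y) -> U x ->
  {near x, f =1 g}.
Proof. by move=> oU fg Ux; near=> y; apply: fg; near: y; exact: open_nbhs_nbhs.
Unshelve. all: by end_near. Qed.

Lemma eq_continuous_on U f g : open U -> (forall x, U x -> f x = g x) ->
  (forall x, U x -> {for x, continuous f}) ->
  forall x, U x -> {for x, continuous g}.
Proof.
move=> oU fg cf x Ux; rewrite /prop_for /continuous_at -(fg _ Ux).
exact: cvg_trans (near_eq_cvg (open_near_eq oU fg Ux)) (cf x Ux).
Qed.

Lemma eq_Ck k U f g : open U -> (forall x, U x -> f x = g x) ->
  Ck k U f -> Ck k U g.
Proof.
move=> oU; elim: k f g => [|k IH] f g fg [cf Df].
  by split=> //; exact: eq_continuous_on cf.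
split=> [|i]; first exact: eq_continuous_on cf.
have [df Dfk] := Df i; split.
  by move=> x Ux; apply: near_eq_derivable (df x Ux); exact: open_near_eq Ux.
apply: IH Dfk => x Ux.
by apply: near_eq_derive; exact: open_near_eq Ux.
Qed.

Lemma CkS k U V f : V `<=` U -> Ck k U f -> Ck k V f.
Proof.
move=> VU; elim: k f => [|k IH] f [cf Df].
  by split=> // x /VU; exact: cf.
split=> [x /VU|i]; first exact: cf.
by have [df /IH] := Df i; split=> // x /VU; exact: df.
Qed.

Lemma Ck_cst k U (c : R) : Ck k U (cst c).
Proof.
elim: k c => [|k IH] c; first by split=> // x _; exact: cst_continuous.
split=> [x _|i]; first exact: cst_continuous.
split=> [x _|]; first exact: derivable_cst.
suff -> : 'D_(delta_mx 0 i) (cst c) = cst 0 :> ('rV[R]_n -> R) by exact: IH.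
by apply/funext => x; rewrite derive_cst.
Qed.

Lemma CkD k U f g : open U -> Ck k U f -> Ck k U g -> Ck k U (f + g).
Proof.
move=> oU; elim: k f g => [|k IH] f g [cf Df] [cg Dg].
  by split=> // x Ux; apply: continuousD; [exact: cf|exact: cg].
split=> [x Ux|i]; first by apply: continuousD; [exact: cf|exact: cg].
have [df Dfk] := Df i; have [dg Dgk] := Dg i; split.
  by move=> x Ux; apply: derivableD; [exact: df|exact: dg].
apply: (eq_Ck oU _ (IH _ _ Dfk Dgk)) => x Ux.
by rewrite deriveD //; [exact: df|exact: dg].
Qed.

Lemma CkM k U f g : open U -> Ck k U f -> Ck k U g -> Ck k U (f * g).
Proof.
move=> oU; elim: k f g => [|k IH] f g Cf Cg; have cfg x : U x ->
    {for x, continuous (f * g)}.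
- by move=> Ux; apply: continuousM; [exact: Ck_cont Cf Ux|exact: Ck_cont Cg Ux].
- by split.
- by move=> Ux; apply: continuousM; [exact: Ck_cont Cf Ux|exact: Ck_cont Cg Ux].
case: (Cf) (Cg) => [cf Df] [cg Dg]; split=> // i.
have [df Dfk] := Df i; have [dg Dgk] := Dg i; split.
  by move=> x Ux; apply: derivableM; [exact: df|exact: dg].
have Ck1 := CkD oU (IH _ _ (CkW Cf) Dgk) (IH _ _ (CkW Cg) Dfk).
apply: (eq_Ck oU _ Ck1) => x Ux.
by rewrite deriveM //; [exact: df|exact: dg].
Qed.

End smooth_rn.

(* The charts cto i : cdom i -> cimg i and their inverses cof i are total
   functions whose values outside cdom i and cimg i are junk. *)
Record manifold (R : realType) (n : nat) := Manifold {
  mpoint :> topologicalType ;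
  mpoint_hausdorff : hausdorff_space mpoint ;
  mpoint_countable : @second_countable mpoint ;
  chart : Type ;
  cdom : chart -> set mpoint ;
  cimg : chart -> set 'rV[R]_n ;
  cto : chart -> mpoint -> 'rV[R]_n ;
  cof : chart -> 'rV[R]_n -> mpoint ;
  cdom_open : forall i, open (cdom i) ;
  cimg_open : forall i, open (cimg i) ;
  cdom_cover : forall x, exists i, cdom i x ;
  cto_img : forall i x, cdom i x -> cimg i (cto i x) ;
  cof_dom : forall i y, cimg i y -> cdom i (cof i y) ;
  ctoK : forall i x, cdom i x -> cof i (cto i x) = x ;
  cofK : forall i y, cimg i y -> cto i (cof i y) = y ;
  cto_continuous : forall i x, cdom i x -> {for x, continuous (cto i)} ;
  cof_continuous : forall i y, cimg i y -> {for y, continuous (cof i)} ;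
  transition_smooth : forall i j k,
    smooth_on (cimg i `&` cof i @^-1` cdom j) (fun y => cto j (cof i y) 0 k)
}.

(* Meaningful for open W only. *)
Definition msmooth (R : realType) n (M : manifold R n) (W : set M)
    (f : M -> R) :=
  forall i : chart M,
    smooth_on (cimg i `&` cof i @^-1` W) (fun y => f (cof i y)).

Section msmooth_theory.
Variables (R : realType) (n : nat) (M : manifold R n).
Implicit Types (W : set M) (f g : M -> R).

Lemma cimg_preimage_open W (i : chart M) : open W ->
  open (cimg i `&` cof i @^-1` W).
Proof.
move=> oW; rewrite openE => y [iy Wy].
apply: filterI; first by apply: open_nbhs_nbhs; split; [exact: cimg_open|].
exact: (cof_continuous iy) (open_nbhs_nbhs (conj oW Wy)).
Qed.

Lemma msmoothS W W' f : W' `<=` W -> msmooth W f -> msmooth W' f.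
Proof.
by move=> WW sf i k; apply: CkS (sf i k) => y [iy Wy]; split=> //; exact: WW.
Qed.

Lemma msmooth_cst W (c : R) : msmooth W (fun=> c).
Proof. by move=> i k; exact: Ck_cst. Qed.

Lemma msmoothD W f g : open W -> msmooth W f -> msmooth W g ->
  msmooth W (fun x => f x + g x).
Proof.
by move=> oW sf sg i k; apply: CkD (sf i k) (sg i k); exact: cimg_preimage_open.
Qed.

Lemma msmoothM W f g : open W -> msmooth W f -> msmooth W g ->
  msmooth W (fun x => f x * g x).
Proof.
by move=> oW sf sg i k; apply: CkM (sf i k) (sg i k); exact: cimg_preimage_open.
Qed.

Lemma msmoothN W f : open W -> msmooth W f -> msmooth W (fun x => - f x).
Proof.
move=> oW sf; have := msmoothM oW (msmooth_cst W (-1)) sf.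
by congr msmooth; apply/funext => x; rewrite mulN1r.
Qed.

End msmooth_theory.

Record cinfty (R : realType) n (M : manifold R n) := CInfty {
  cinfty_fun :> M -> R ;
  cinfty_smooth : msmooth setT cinfty_fun
}.

Section cinfty_ring.
Variables (R : realType) (n : nat) (M : manifold R n).
Implicit Types f g h : cinfty M.

Lemma cinfty_eq f g : (forall x, f x = g x) -> f = g.
Proof.
case: f g => [f sf] [g sg] /= /funext fg; case: _ / fg sg => sg.
by congr CInfty; exact: Prop_irrelevance.
Qed.

HB.instance Definition _ := gen_eqMixin (cinfty M).
HB.instance Definition _ := gen_choiceMixin (cinfty M).

Definition cinfty_cst (c : R) : cinfty M :=
  CInfty (msmooth_cst [set: M] c).
Definition cinfty_add f g : cinfty M :=
  CInfty (msmoothD openT (cinfty_smooth f) (cinfty_smooth g)).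
Definition cinfty_opp f : cinfty M :=
  CInfty (msmoothN openT (cinfty_smooth f)).
Definition cinfty_mul f g : cinfty M :=
  CInfty (msmoothM openT (cinfty_smooth f) (cinfty_smooth g)).

Fact cinfty_addA : associative cinfty_add.
Proof. by move=> f g h; apply: cinfty_eq => x /=; rewrite addrA. Qed.
Fact cinfty_addC : commutative cinfty_add.
Proof. by move=> f g; apply: cinfty_eq => x /=; rewrite addrC. Qed.
Fact cinfty_add0 : left_id (cinfty_cst 0) cinfty_add.
Proof. by move=> f; apply: cinfty_eq => x /=; rewrite add0r. Qed.
Fact cinfty_addN : left_inverse (cinfty_cst 0) cinfty_opp cinfty_add.
Proof. by move=> f; apply: cinfty_eq => x /=; rewrite addNr. Qed.
HB.instance Definition _ := GRing.isZmodule.Build (cinfty M)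
  cinfty_addA cinfty_addC cinfty_add0 cinfty_addN.

Fact cinfty_mulA : associative cinfty_mul.
Proof. by move=> f g h; apply: cinfty_eq => x /=; rewrite mulrA. Qed.
Fact cinfty_mulC : commutative cinfty_mul.
Proof. by move=> f g; apply: cinfty_eq => x /=; rewrite mulrC. Qed.
Fact cinfty_mul1 : left_id (cinfty_cst 1) cinfty_mul.
Proof. by move=> f; apply: cinfty_eq => x /=; rewrite mul1r. Qed.
Fact cinfty_mulD : left_distributive cinfty_mul +%R.
Proof. by move=> f g h; apply: cinfty_eq => x /=; rewrite mulrDl. Qed.
HB.instance Definition _ := GRing.Zmodule_isComPzRing.Build (cinfty M)
  cinfty_mulA cinfty_mulC cinfty_mul1 cinfty_mulD.

Lemma cinftyDE f g x : (f + g) x = f x + g x. Proof. by []. Qed.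
Lemma cinftyNE f x : (- f) x = - f x. Proof. by []. Qed.
Lemma cinftyBE f g x : (f - g) x = f x - g x. Proof. by []. Qed.
Lemma cinftyME f g x : (f * g) x = f x * g x. Proof. by []. Qed.
Lemma cinfty0E x : (0 : cinfty M) x = 0. Proof. by []. Qed.
Lemma cinfty1E x : (1 : cinfty M) x = 1. Proof. by []. Qed.
Definition cinftyE :=
  (cinftyBE, cinftyDE, cinftyNE, cinftyME, cinfty0E, cinfty1E).

End cinfty_ring.

(* Trivializations are not assumed to be defined over the chart domains of M. A
   bundle is its fibers together with a smooth cocycle, which determines the
   smooth structure of the total space. *)
Record vector_bundle (R : realType) n (M : manifold R n) (r : nat) :=
  VectorBundle {
  fiber : M -> lmodType R ;
  triv_idx : Type ;
  triv_dom : triv_idx -> set M ;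
  triv : forall (j : triv_idx) (x : M), {linear fiber x -> 'rV[R]_r} ;
  triv_dom_open : forall j, open (triv_dom j) ;
  triv_dom_cover : forall x, exists j, triv_dom j x ;
  triv_bij : forall j x, triv_dom j x -> bijective (triv j x) ;
  triv_transition : forall j k, exists g : M -> 'M[R]_r,
    (forall a b, msmooth (triv_dom j `&` triv_dom k) (fun x => g x a b)) /\
    (forall x v, triv_dom j x -> triv_dom k x ->
       triv k x v = triv j x v *m g x)
}.

Record section (R : realType) n (M : manifold R n) r
    (A : vector_bundle M r) := Section_ {
  section_fun :> forall x, fiber A x ;
  section_smooth : forall (j : triv_idx A) (a : 'I_r),
    msmooth (triv_dom j) (fun x => triv j x (section_fun x) 0 a)
}.

Section section_module.
Variables (R : realType) (n : nat) (M : manifold R n) (r : nat).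
Variable A : vector_bundle M r.
Implicit Types (X Y Z : section A) (f g : cinfty M).

Lemma section_eq X Y : (forall x, X x = Y x) -> X = Y.
Proof.
case: X Y => [X sX] [Y sY] /= XY.
have {}XY : X = Y by apply: functional_extensionality_dep.
case: _ / XY sY => sY.
by congr Section_; exact: Prop_irrelevance.
Qed.

HB.instance Definition _ := gen_eqMixin (section A).
HB.instance Definition _ := gen_choiceMixin (section A).

Fact section_zero_smooth (j : triv_idx A) (a : 'I_r) :
  msmooth (triv_dom j) (fun x => triv j x 0 0 a).
Proof.
have := msmooth_cst (triv_dom j) 0.
by congr msmooth; apply/funext => x; rewrite linear0 mxE.
Qed.
Definition section_zero : section A := Section_ section_zero_smooth.

Fact section_add_smooth X Y (j : triv_idx A) (a : 'I_r) :
  msmooth (triv_dom j) (fun x => triv j x (X x + Y x) 0 a).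
Proof.
have := msmoothD (triv_dom_open j) (section_smooth X j a) (section_smooth Y j a).
by congr msmooth; apply/funext => x; rewrite linearD mxE.
Qed.
Definition section_add X Y : section A := Section_ (section_add_smooth X Y).

Fact section_opp_smooth X (j : triv_idx A) (a : 'I_r) :
  msmooth (triv_dom j) (fun x => triv j x (- X x) 0 a).
Proof.
have := msmoothN (triv_dom_open j) (section_smooth X j a).
by congr msmooth; apply/funext => x; rewrite linearN mxE.
Qed.
Definition section_opp X : section A := Section_ (section_opp_smooth X).

Fact section_scale_smooth f X (j : triv_idx A) (a : 'I_r) :
  msmooth (triv_dom j) (fun x => triv j x (f x *: X x) 0 a).
Proof.
have sf : msmooth (triv_dom j) f by apply: msmoothS (cinfty_smooth f).
have := msmoothM (triv_dom_open j) sf (section_smooth X j a).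
by congr msmooth; apply/funext => x; rewrite linearZ mxE.
Qed.
Definition section_scale f X : section A := Section_ (section_scale_smooth f X).

Fact section_addA : associative section_add.
Proof. by move=> X Y Z; apply: section_eq => x /=; rewrite addrA. Qed.
Fact section_addC : commutative section_add.
Proof. by move=> X Y; apply: section_eq => x /=; rewrite addrC. Qed.
Fact section_add0 : left_id section_zero section_add.
Proof. by move=> X; apply: section_eq => x /=; rewrite add0r. Qed.
Fact section_addN : left_inverse section_zero section_opp section_add.
Proof. by move=> X; apply: section_eq => x /=; rewrite addNr. Qed.
HB.instance Definition _ := GRing.isZmodule.Build (section A)
  section_addA section_addC section_add0 section_addN.

Fact section_scaleA f g X :
  section_scale f (section_scale g X) = section_scale (f * g) X.
Proof. by apply: section_eq => x /=; rewrite scalerA. Qed.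
Fact section_scale1 : left_id 1 section_scale.
Proof. by move=> X; apply: section_eq => x /=; rewrite scale1r. Qed.
Fact section_scaleDr : right_distributive section_scale +%R.
Proof. by move=> f X Y; apply: section_eq => x /=; rewrite scalerDr. Qed.
Fact section_scaleDl X : {morph section_scale^~ X : f g / f + g}.
Proof. by move=> f g; apply: section_eq => x /=; rewrite scalerDl. Qed.
HB.instance Definition _ := GRing.Zmodule_isLmodule.Build (cinfty M) (section A)
  section_scaleA section_scale1 section_scaleDr section_scaleDl.

End section_module.

(* Gamma(A^* ) and, below, sections of the other tensor bundles and bundle maps are
   represented by C^oo(M)-multilinear maps between modules of sections. *)
Record cosection (R : realType) n (M : manifold R n) r
    (A : vector_bundle M r) := Cosection {
  cosection_fun :> section A -> cinfty M ;
  cosection_linear : forall (f : cinfty M) (X Y : section A),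
    cosection_fun (f *: X + Y) = f * cosection_fun X + cosection_fun Y
}.

Section cosection_module.
Variables (R : realType) (n : nat) (M : manifold R n) (r : nat).
Variable A : vector_bundle M r.
Implicit Types (X Y : section A) (f g : cinfty M) (al be : cosection A).

HB.instance Definition _ al := GRing.isLinear.Build (cinfty M) (section A)
  (cinfty M) *%R al (cosection_linear al).

Lemma cosection_eq al be : (forall X, al X = be X) -> al = be.
Proof.
case: al be => [al la] [be lb] /= /funext ab; case: _ / ab lb => lb.
by congr Cosection; exact: Prop_irrelevance.
Qed.

HB.instance Definition _ := gen_eqMixin (cosection A).
HB.instance Definition _ := gen_choiceMixin (cosection A).

Fact cosection_zero_linear f X Y :
  (0 : cinfty M) = f * (0 : cinfty M) + 0.
Proof. by rewrite mulr0 addr0. Qed.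
Definition cosection_zero : cosection A := Cosection cosection_zero_linear.

Fact cosection_add_linear al be f X Y :
  al (f *: X + Y) + be (f *: X + Y) = f * (al X + be X) + (al Y + be Y).
Proof. by rewrite !cosection_linear mulrDr addrACA. Qed.
Definition cosection_add al be : cosection A :=
  Cosection (cosection_add_linear al be).

Fact cosection_opp_linear al f X Y :
  - al (f *: X + Y) = f * (- al X) + - al Y.
Proof. by rewrite cosection_linear opprD mulrN. Qed.
Definition cosection_opp al : cosection A := Cosection (cosection_opp_linear al).

Fact cosection_scale_linear g al f X Y :
  g * al (f *: X + Y) = f * (g * al X) + g * al Y.
Proof. by rewrite cosection_linear mulrDr mulrCA. Qed.
Definition cosection_scale g al : cosection A :=
  Cosection (cosection_scale_linear g al).

Fact cosection_addA : associative cosection_add.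
Proof. by move=> a b c; apply: cosection_eq => x /=; rewrite addrA. Qed.
Fact cosection_addC : commutative cosection_add.
Proof. by move=> a b; apply: cosection_eq => x /=; rewrite addrC. Qed.
Fact cosection_add0 : left_id cosection_zero cosection_add.
Proof. by move=> a; apply: cosection_eq => x /=; rewrite add0r. Qed.
Fact cosection_addN : left_inverse cosection_zero cosection_opp cosection_add.
Proof. by move=> a; apply: cosection_eq => x /=; rewrite addNr. Qed.
HB.instance Definition _ := GRing.isZmodule.Build (cosection A)
  cosection_addA cosection_addC cosection_add0 cosection_addN.

Fact cosection_scaleA f g al :
  cosection_scale f (cosection_scale g al) = cosection_scale (f * g) al.
Proof. by apply: cosection_eq => x /=; rewrite mulrA. Qed.
Fact cosection_scale1 : left_id 1 cosection_scale.
Proof. by move=> a; apply: cosection_eq => x /=; rewrite mul1r. Qed.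
Fact cosection_scaleDr : right_distributive cosection_scale +%R.
Proof. by move=> f a b; apply: cosection_eq => x /=; rewrite mulrDr. Qed.
Fact cosection_scaleDl al : {morph cosection_scale^~ al : f g / f + g}.
Proof. by move=> f g; apply: cosection_eq => x /=; rewrite mulrDl. Qed.
HB.instance Definition _ := GRing.Zmodule_isLmodule.Build (cinfty M)
  (cosection A)
  cosection_scaleA cosection_scale1 cosection_scaleDr cosection_scaleDl.

Lemma cosectionDE al be X : (al + be) X = al X + be X. Proof. by []. Qed.
Lemma cosectionNE al X : (- al) X = - al X. Proof. by []. Qed.
Lemma cosectionBE al be X : (al - be) X = al X - be X. Proof. by []. Qed.
Lemma cosectionZE f al X : (f *: al) X = f * al X. Proof. by []. Qed.
Lemma cosection0E X : (0 : cosection A) X = 0. Proof. by []. Qed.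
Definition cosectionE :=
  (cosectionBE, cosectionDE, cosectionNE, cosectionZE, cosection0E).

End cosection_module.

Section tensors.
Variables (R : realType) (n : nat) (M : manifold R n) (r : nat).
Variable A : vector_bundle M r.

Record form2 := Form2 {
  form2_fun :> section A -> section A -> cinfty M ;
  form2_linearl : forall Y f X X',
    form2_fun (f *: X + X') Y = f * form2_fun X Y + form2_fun X' Y ;
  form2_linearr : forall X f Y Y',
    form2_fun X (f *: Y + Y') = f * form2_fun X Y + form2_fun X Y' ;
  form2_alt : forall X, form2_fun X X = 0
}.

Definition flat (omega : form2) (X : section A) : cosection A :=
  Cosection (form2_linearr omega X).

Fact flat_linear omega : linear (flat omega).
Proof. by move=> f X Y; apply: cosection_eq => Z /=; rewrite form2_linearl. Qed.
HB.instance Definition _ omega := GRing.isLinear.Build (cinfty M) (section A)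
  (cosection A) *:%R (flat omega) (flat_linear omega).

Definition nondegenerate (omega : form2) := bijective (flat omega).

(* Multivectors are given with their last argument raised: a section pi of
   wedge^2 A is the skew-symmetric bundle map pi^sharp : A^* -> A with
   pi(al, be) = <be, pi^sharp al>, and a section psi of wedge^3 A is the bilinear
   bundle map with psi(al, be, ga) = <ga, psi al be>. *)
Record bivector := Bivector {
  sharp : {linear cosection A -> section A} ;
  bivector_alt : forall al : cosection A, al (sharp al) = 0
}.

Record trivector := Trivector {
  raised :> cosection A -> cosection A -> section A ;
  trivector_linearl : forall be, linear (raised^~ be) ;
  trivector_linearr : forall al, linear (raised al) ;
  trivector_alt12 : forall al, raised al al = 0 ;
  trivector_alt23 : forall al be : cosection A, be (raised al be) = 0
}.

Definition inverse_of (pi : bivector) (omega : form2) :=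
  forall X : section A, sharp pi (flat omega X) = X.

End tensors.

(* lrho X is the derivation of C^oo(M) given by the vector field rho(X); it is
   C^oo(M)-linear in X since rho : A -> TM is a bundle map. *)
Record lie_algebroid (R : realType) n (M : manifold R n) r
    (A : vector_bundle M r) := LieAlgebroid {
  lbr : section A -> section A -> section A ;
  lrho : section A -> cinfty M -> cinfty M ;
  lrho_linear : forall f X Y g, lrho (f *: X + Y) g = f * lrho X g + lrho Y g ;
  lrhoD : forall X f g, lrho X (f + g) = lrho X f + lrho X g ;
  lrho_cst : forall X (c : R), lrho X (cinfty_cst M c) = 0 ;
  lrhoM : forall X f g, lrho X (f * g) = lrho X f * g + f * lrho X g ;
  lbr_linearl : forall Z (c : R) X Y,
    lbr (cinfty_cst M c *: X + Y) Z = cinfty_cst M c *: lbr X Z + lbr Y Z ;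
  lbr_linearr : forall X (c : R) Y Z,
    lbr X (cinfty_cst M c *: Y + Z) = cinfty_cst M c *: lbr X Y + lbr X Z ;
  lbr_alt : forall X, lbr X X = 0 ;
  lbr_jacobi : forall X Y Z,
    lbr X (lbr Y Z) + lbr Y (lbr Z X) + lbr Z (lbr X Y) = 0 ;
  lbr_leibniz : forall X f Y, lbr X (f *: Y) = f *: lbr X Y + lrho X f *: Y
}.

Section lie_algebroid_calculus.
Variables (R : realType) (n : nat) (M : manifold R n) (r : nat).
Variables (A : vector_bundle M r) (L : lie_algebroid A).
Implicit Types (X Y Z : section A) (f g : cinfty M) (al be : cosection A).

Lemma lbrDr X Y Z : lbr L X (Y + Z) = lbr L X Y + lbr L X Z.
Proof.
have := lbr_linearr L X 1 Y Z.
by rewrite -[cinfty_cst M 1]/(1 : cinfty M) !scale1r.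
Qed.

Lemma lbrDl X Y Z : lbr L (X + Y) Z = lbr L X Z + lbr L Y Z.
Proof.
have := lbr_linearl L Z 1 X Y.
by rewrite -[cinfty_cst M 1]/(1 : cinfty M) !scale1r.
Qed.

Lemma lbr_skew X Y : lbr L X Y = - lbr L Y X.
Proof.
apply/eqP; rewrite -addr_eq0; apply/eqP.
have := lbr_alt L (X + Y).
by rewrite lbrDl !lbrDr !lbr_alt add0r addr0.
Qed.

(* The Lie algebroid differential on 1-forms and 2-forms. *)
Definition d1 al X Y : cinfty M :=
  lrho L X (al Y) - lrho L Y (al X) - al (lbr L X Y).

Definition d2 (omega : form2 A) X Y Z : cinfty M :=
  lrho L X (omega Y Z) - lrho L Y (omega X Z) + lrho L Z (omega X Y)
  - omega (lbr L X Y) Z + omega (lbr L X Z) Y - omega (lbr L Y Z) X.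

Fact d1_linear al X f Y Z :
  d1 al X (f *: Y + Z) = f * d1 al X Y + d1 al X Z.
Proof.
rewrite /d1 cosection_linear lrhoD lrhoM lrho_linear lbrDr lbr_leibniz.
rewrite !raddfD /= !linearZ /=.
by apply: cinfty_eq => x; rewrite !cinftyE; ring.
Qed.
Definition interior_d1 X al : cosection A := Cosection (d1_linear al X).

Fact lie_deriv_linear X be f Y Z :
  lrho L X (be (f *: Y + Z)) - be (lbr L X (f *: Y + Z)) =
  f * (lrho L X (be Y) - be (lbr L X Y)) + (lrho L X (be Z) - be (lbr L X Z)).
Proof.
rewrite cosection_linear lrhoD lrhoM lbrDr lbr_leibniz.
rewrite !raddfD /= !linearZ /=.
by apply: cinfty_eq => x; rewrite !cinftyE; ring.
Qed.
Definition lie_deriv X be : cosection A := Cosection (lie_deriv_linear X be).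

End lie_algebroid_calculus.

Notation bisection A := (section A * cosection A)%type.

Section pre_courant.
Variables (R : realType) (n : nat) (M : manifold R n) (r : nat).
Variable A : vector_bundle M r.
Implicit Types (e : bisection A) (f g : cinfty M).

Definition pairing e1 e2 : cinfty M := e1.2 e2.1 + e2.2 e1.1.

(* An element Theta of total degree 3 is given by its derived brackets, the anchor
   {{e,Theta},f} and the Dorfman bracket {{e,Theta},e'}; a deformation Theta_I need
   not satisfy the pre-Courant axioms. *)
Record theta := Theta {
  anchor : bisection A -> cinfty M -> cinfty M ;
  dorfman : bisection A -> bisection A -> bisection A
}.

Record is_pre_courant (T : theta) : Prop := IsPreCourant {
  anchor_linear : forall f e1 e2 g,
    anchor T (f *: e1 + e2) g = f * anchor T e1 g + anchor T e2 g ;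
  anchorD : forall e f g, anchor T e (f + g) = anchor T e f + anchor T e g ;
  anchor_cst : forall e (c : R), anchor T e (cinfty_cst M c) = 0 ;
  anchorM : forall e f g, anchor T e (f * g) = anchor T e f * g + f * anchor T e g ;
  anchor_pairingl : forall e e1 e2,
    anchor T e (pairing e1 e2) =
    pairing (dorfman T e e1) e2 + pairing e1 (dorfman T e e2) ;
  anchor_pairingr : forall e e1 e2,
    anchor T e (pairing e1 e2) = pairing e (dorfman T e1 e2 + dorfman T e2 e1)
}.

Definition theta_add (T1 T2 : theta) := Theta
  (fun e f => anchor T1 e f + anchor T2 e f)
  (fun e1 e2 => dorfman T1 e1 e2 + dorfman T2 e1 e2).

Record pre_courant := PreCourant {
  pre_courant_theta :> theta ;
  pre_courantP : is_pre_courant pre_courant_theta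
}.

Lemma pairingDl e1 e2 e : pairing (e1 + e2) e = pairing e1 e + pairing e2 e.
Proof. by rewrite /pairing [e.2 (e1 + e2).1]raddfD /= addrACA. Qed.

Lemma pairingC e1 e2 : pairing e1 e2 = pairing e2 e1.
Proof. exact: addrC. Qed.

Lemma pairingDr e1 e2 e : pairing e (e1 + e2) = pairing e e1 + pairing e e2.
Proof. by rewrite pairingC pairingDl ![pairing _ e]pairingC. Qed.

Fact pre_courant_addP (T1 T2 : pre_courant) : is_pre_courant (theta_add T1 T2).
Proof.
have [l1 D1 c1 M1 p1 q1] := pre_courantP T1.
have [l2 D2 c2 M2 p2 q2] := pre_courantP T2.
split=> /=.
- by move=> f e1 e2 g; rewrite l1 l2 mulrDr addrACA.
- by move=> e f g; rewrite D1 D2 addrACA.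
- by move=> e c; rewrite c1 c2 addr0.
- by move=> e f g; rewrite M1 M2 mulrDl mulrDr addrACA.
- by move=> e e1 e2; rewrite p1 p2 pairingDl pairingDr addrACA.
- by move=> e e1 e2; rewrite q1 q2 -pairingDr addrACA.
Qed.
Definition pre_courant_add (T1 T2 : pre_courant) : pre_courant :=
  PreCourant (pre_courant_addP T1 T2).

(* The derived brackets of mu in F^(1,2): {{X,mu},Y} = [X,Y], {{al,mu},be} = 0 by
   bidegree, and the sections {{X,mu},be} = L_X be and {{al,mu},Y} = - i_Y d al of
   A^* are forced by the pre-Courant identities, see pre_courant_mixedl and
   pre_courant_mixedr. *)
Definition theta_of_lie (L : lie_algebroid A) := Theta
  (fun e f => lrho L e.1 f)
  (fun e1 e2 => (lbr L e1.1 e2.1,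
                 lie_deriv L e1.1 e2.2 - interior_d1 L e2.1 e1.2)).

Fact theta_of_lieP L : is_pre_courant (theta_of_lie L).
Proof.
split=> /=.
- by move=> f e1 e2 g; rewrite lrho_linear.
- by move=> e f g; rewrite lrhoD.
- by move=> e c; rewrite lrho_cst.
- by move=> e f g; rewrite lrhoM.
- move=> [X al] [Y be] [Z ga]; rewrite /pairing /= /d1 /= lrhoD.
  rewrite (lbr_skew L Z Y) raddfN /=.
  by apply: cinfty_eq => x; rewrite !cinftyE; ring.
- move=> [X al] [Y be] [Z ga]; rewrite /pairing /= /d1 /= lrhoD.
  rewrite (lbr_skew L Z Y) subrr raddf0 (lbr_skew L Y X) (lbr_skew L Z X).
  rewrite !raddfN /=.
  by apply: cinfty_eq => x; rewrite !cinftyE; ring.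
Qed.

Definition pre_courant_of_lie L : pre_courant := PreCourant (theta_of_lieP L).

Lemma pre_courant_mixedl (L : lie_algebroid A) (T : pre_courant) :
    (forall X f, anchor T (X, 0) f = lrho L X f) ->
    (forall X Y, dorfman T (X, 0) (Y, 0) = (lbr L X Y, 0)) ->
    (forall X be, (dorfman T (X, 0) (0, be)).1 = 0) ->
  forall X be, dorfman T (X, 0) (0, be) = (0, lie_deriv L X be).
Proof.
move=> rhoT brT TA X be; have := TA X be.
case E: (dorfman T (X, 0) (0, be)) => [Z ga] /= ->; congr pair.
apply: cosection_eq => Y /=.
have := anchor_pairingl (pre_courantP T) (X, 0) (0, be) (Y, 0).
rewrite E brT rhoT /pairing /= !addr0 => ->.
by rewrite addrK.
Qed.

Lemma pre_courant_mixedr (L : lie_algebroid A) (T : pre_courant) :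
    (forall X f, anchor T (X, 0) f = lrho L X f) ->
    (forall X Y, dorfman T (X, 0) (Y, 0) = (lbr L X Y, 0)) ->
    (forall X be, (dorfman T (X, 0) (0, be)).1 = 0) ->
    (forall al Y, (dorfman T (0, al) (Y, 0)).1 = 0) ->
  forall al Y, dorfman T (0, al) (Y, 0) = (0, - interior_d1 L Y al).
Proof.
move=> rhoT brT TA TA' al Y; have := TA' al Y.
case E: (dorfman T (0, al) (Y, 0)) => [Z ga] /= ->; congr pair.
apply: cosection_eq => X /=.
have := anchor_pairingr (pre_courantP T) (X, 0) (0, al) (Y, 0).
rewrite E (pre_courant_mixedl rhoT brT TA) rhoT /pairing /=.
rewrite !addr0 add0r /d1 => H.
rewrite [ga X](_ : _ = lrho L X (al Y) - (lrho L Y (al X) - al (lbr L Y X))).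
  by apply: cinfty_eq => x; rewrite !cinftyE; ring.
by rewrite H addrK.
Qed.

(* The only nonzero derived bracket of psi in F^(3,0) is
   {{al,psi},be} = - {be,{al,psi}} = - psi(al, be, -), and its anchor is zero. *)
Definition theta_of_trivector (psi : trivector A) := Theta
  (fun _ _ => 0)
  (fun e1 e2 => (- psi e1.2 e2.2, 0)).

Lemma trivector_skew12 (psi : trivector A) al be : psi al be = - psi be al.
Proof.
apply/eqP; rewrite -addr_eq0; apply/eqP.
have := trivector_alt12 psi (al + be).
have Dl a b c : psi (a + b) c = psi a c + psi b c.
  by have := trivector_linearl psi c 1 a b; rewrite !scale1r.
have Dr a b c : psi a (b + c) = psi a b + psi a c.
  by have := trivector_linearr psi a 1 b c; rewrite !scale1r.
by rewrite Dl !Dr !trivector_alt12 add0r addr0.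
Qed.

Lemma trivector_skew23 (psi : trivector A) (al be ga : cosection A) :
  ga (psi al be) = - be (psi al ga).
Proof.
apply/eqP; rewrite -addr_eq0; apply/eqP.
have := trivector_alt23 psi al (be + ga).
have Dr a b c : psi a (b + c) = psi a b + psi a c.
  by have := trivector_linearr psi a 1 b c; rewrite !scale1r.
by rewrite Dr raddfD /= !trivector_alt23 add0r addr0.
Qed.

Fact theta_of_trivectorP psi : is_pre_courant (theta_of_trivector psi).
Proof.
split=> //=.
- by move=> f e1 e2 g; rewrite mulr0 addr0.
- by move=> e f g; rewrite addr0.
- by move=> e f g; rewrite mul0r mulr0 addr0.
- move=> [X al] [Y be] [Z ga]; rewrite /pairing /= !raddfN /=.
  by rewrite trivector_skew23 opprK add0r addr0 subrr.
- move=> [X al] [Y be] [Z ga]; rewrite /pairing /=.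
  by rewrite (trivector_skew12 psi ga be) opprK addNr raddf0 !addr0.
Qed.

Definition pre_courant_of_trivector psi : pre_courant :=
  PreCourant (theta_of_trivectorP psi).

End pre_courant.

Section hypersymplectic.
Variables (R : realType) (n : nat) (M : manifold R n) (r : nat).
Variable A : vector_bundle M r.

Definition deform (T : theta A) (I : bisection A -> bisection A) := Theta
  (fun e f => anchor T (I e) f)
  (fun e1 e2 => dorfman T (I e1) e2 + dorfman T e1 (I e2) - I (dorfman T e1 e2)).

Definition theta_opp (T : theta A) := Theta
  (fun e f => - anchor T e f) (fun e1 e2 => - dorfman T e1 e2).

(* The indices 1, 2, 3 are the elements of 'Z_3, with 3 = 0. *)
Definition hypersymplectic (T : pre_courant A)
    (S : 'Z_3 -> {linear bisection A -> bisection A}) :=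
  [/\ forall i e1 e2, pairing (S i e1) e2 = - pairing e1 (S i e2),
      forall i e, S i (S i e) = - e,
      forall i j e, i != j -> S i (S j e) = - S j (S i e) &
      forall i, deform (deform T (S i)) (S i) = theta_opp T].

Definition Smap (omega : form2 A) (pi : bivector A) (e : bisection A) :
  bisection A := (- sharp pi e.2, flat omega e.1).

Fact Smap_linear omega pi : linear (Smap omega pi).
Proof.
move=> f [X al] [Y be]; rewrite /Smap /= linearP /=.
by congr pair; rewrite ?linearP // opprD scalerN.
Qed.
HB.instance Definition _ omega pi := GRing.isLinear.Build (cinfty M)
  (bisection A) (bisection A) *:%R (Smap omega pi) (Smap_linear omega pi).

End hypersymplectic.

Section hypersymplectic_torsion.
Variables (R : realType) (n : nat) (M : manifold R n) (r : nat).
Variables (A : vector_bundle M r) (L : lie_algebroid A).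
Variable omega : 'Z_3 -> form2 A.

Definition transition (pi : 'Z_3 -> bivector A) (i : 'Z_3) (X : section A) :
  section A := sharp (pi (i - 1)) (flat (omega (i + 1)) X).

Definition hypersymplectic_torsion : Prop :=
  (forall i, nondegenerate (omega i)) /\
  exists pi : 'Z_3 -> bivector A,
    [/\ forall i, inverse_of (pi i) (omega i),
        forall i X, transition pi i (transition pi i X) = - X &
        forall i j X Y Z,
          let N := transition pi in
          d2 L (omega i) (N i X) (N i Y) (N i Z) =
          d2 L (omega j) (N j X) (N j Y) (N j Z)].

End hypersymplectic_torsion.

(* Main.v *)
(* Since S_i^2 = -1, the condition Theta_{S_i,S_i} = - Theta says that twice the
   Nijenhuis torsion of S_i vanishes. This torsion is antilinear for S_i in both
   arguments and A^* = S_i(A), so it vanishes as soon as it does on sections of A,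
   where it equals pi_i(i_Y i_X d omega_i) - psi(omega_i X, omega_i Y). Hence
   d omega_i(X, Y, Z) = - psi(omega_i X, omega_i Y, omega_i Z) for all i. The
   relation N_i^2 = -1 amounts to the anticommutation of the S_i, which makes
   omega_i N_i independent of i; so such a common psi exists exactly when the
   3-forms N_i d omega_i coincide. *)
Require Import Defs.
From mathcomp Require Import all_boot all_order all_algebra.
From mathcomp Require Import all_classical all_reals all_analysis.
From mathcomp Require Import ring.
Import GRing.Theory Num.Theory.
Local Open Scope ring_scope.

Set Implicit Arguments.
Unset Strict Implicit.

(** The constant function 1/2 is a smooth scalar, so 2 is invertible on every module over smooth
    functions. This removes the factor 2 in front of the Nijenhuis torsion. *)
Lemma double_eq0 (R : realType) n (M : manifold R n) (V : lmodType (cinfty M))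
    (v : V) : v + v = 0 -> v = 0.
Proof.
move=> vv0; have -> : v = cinfty_cst M 2^-1 *: (v + v); last first.
  by rewrite vv0 scaler0.
rewrite scalerDr -scalerDl -[LHS]scale1r; congr (_ *: _).
by apply: cinfty_eq => x; rewrite cinftyDE /=; field.
Qed.

Lemma additive_zero (U V : zmodType) (f : U -> V) :
  {morph f : x y / x + y} -> f 0 = 0.
Proof. by move=> fD; apply: (addrI (f 0)); rewrite -fD !addr0. Qed.

Lemma additive_opp (U V : zmodType) (f : U -> V) :
  {morph f : x y / x + y} -> {morph f : x / - x}.
Proof.
by move=> fD x; apply/eqP; rewrite -addr_eq0 -fD addNr (additive_zero fD).
Qed.

(** * Tensoriality of $d\omega$ and the trivector obtained by raising its indices *)

Section TensorCalculus.
Context (R : realType) (n : nat) (M : manifold R n) (r : nat).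
Context (A : vector_bundle M r) (L : lie_algebroid A).
Implicit Types (omega : form2 A) (X Y Z : section A) (pi : bivector A).
Implicit Types (al be : cosection A).

Lemma form2Dl omega X X' Y : omega (X + X') Y = omega X Y + omega X' Y.
Proof. by have := form2_linearl omega Y 1 X X'; rewrite scale1r mul1r. Qed.

Lemma form2_skew omega X Y : omega X Y = - omega Y X.
Proof.
apply/eqP; rewrite -addr_eq0; apply/eqP; have := form2_alt omega (X + Y).
rewrite form2Dl -[omega X _]/(flat omega X _) -[omega Y _]/(flat omega Y _).
by rewrite !raddfD /= !form2_alt add0r addr0.
Qed.

Lemma form20l omega Y : omega 0 Y = 0.
Proof. by rewrite -[omega 0 Y]/(flat omega 0 Y) raddf0. Qed.

Lemma form2Nl omega X Y : omega (- X) Y = - omega X Y.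
Proof. by rewrite -[LHS]/(flat omega (- X) Y) raddfN. Qed.

Lemma form2Zl omega f X Y : omega (f *: X) Y = f * omega X Y.
Proof. by rewrite -[LHS]/(flat omega (f *: X) Y) linearZ. Qed.

Lemma sharp_skew pi al be : be (sharp pi al) = - al (sharp pi be).
Proof.
apply/eqP; rewrite -addr_eq0 addrC; apply/eqP.
have := bivector_alt pi (al + be).
by rewrite (raddfD (sharp pi)) cosectionDE !raddfD /= !bivector_alt add0r addr0.
Qed.

(** Cyclic symmetry lets linearity be checked in the last slot only; the other two slots are rotated
    into it. *)
Lemma d2_cycle omega X Y Z : d2 L omega X Y Z = d2 L omega Y Z X.
Proof.
rewrite /d2 (lbr_skew L Z X) (lbr_skew L Y X) (form2_skew omega X Z).
rewrite (form2_skew omega X Y).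
rewrite !form2Nl !(additive_opp (lrhoD L _)) //.
by apply: cinfty_eq => x; rewrite !cinftyE; ring.
Qed.

(** The derivatives of [f] produced by the Lie derivative terms cancel those produced by the Leibniz
    rule of the bracket. *)
Lemma d2_linearr omega X Y f Z Z' :
  d2 L omega X Y (f *: Z + Z') = f * d2 L omega X Y Z + d2 L omega X Y Z'.
Proof.
rewrite /d2 !form2_linearr !lrhoD !lrhoM lrho_linear !lbrDr !lbr_leibniz.
rewrite !form2Dl !form2Zl (form2_skew omega Z) (form2_skew omega Z X).
by apply: cinfty_eq => x; rewrite !cinftyE; ring.
Qed.

Lemma d2_linearl omega Y Z f X X' :
  d2 L omega (f *: X + X') Y Z = f * d2 L omega X Y Z + d2 L omega X' Y Z.
Proof. by rewrite !(d2_cycle _ _ Y Z) d2_linearr. Qed.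

Lemma d2_linearm omega X Z f Y Y' :
  d2 L omega X (f *: Y + Y') Z = f * d2 L omega X Y Z + d2 L omega X Y' Z.
Proof. by rewrite !(d2_cycle _ X) d2_linearl. Qed.

Lemma d2_alt12 omega X Z : d2 L omega X X Z = 0.
Proof.
rewrite /d2 lbr_alt form2_alt form20l [lrho L Z 0]lrho_cst.
by apply: cinfty_eq => x; rewrite !cinftyE; ring.
Qed.

Definition contract_d2 omega X Y : cosection A :=
  Cosection (d2_linearr omega X Y).

Definition torsion_raised omega pi al be : section A :=
  sharp pi (contract_d2 omega (sharp pi al) (sharp pi be)).

Fact torsion_linearl omega pi be : linear ((torsion_raised omega pi)^~ be).
Proof.
move=> f al al'; rewrite /torsion_raised -linearP; congr (sharp pi _).
by apply: cosection_eq => Z /=; rewrite linearP d2_linearl.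
Qed.

Fact torsion_linearr omega pi al : linear (torsion_raised omega pi al).
Proof.
move=> f be be'; rewrite /torsion_raised -linearP; congr (sharp pi _).
by apply: cosection_eq => Z /=; rewrite linearP d2_linearm.
Qed.

Fact torsion_alt12 omega pi al : torsion_raised omega pi al al = 0.
Proof.
rewrite /torsion_raised [contract_d2 _ _ _](_ : _ = 0) ?raddf0 //.
by apply: cosection_eq => Z /=; rewrite d2_alt12.
Qed.

Fact torsion_alt23 omega pi al be : be (torsion_raised omega pi al be) = 0.
Proof. by rewrite sharp_skew /= d2_cycle d2_alt12 oppr0. Qed.

(* [psi = - d omega (pi -, pi -, pi -)]. *)
Definition torsion_trivector omega pi : trivector A :=
  Trivector (torsion_linearl omega pi) (torsion_linearr omega pi)
    (torsion_alt12 omega pi) (torsion_alt23 omega pi).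

End TensorCalculus.

(** * Nijenhuis torsion of an almost complex endomorphism *)

Section NijenhuisTorsion.
Context (R : realType) (n : nat) (M : manifold R n) (r : nat).
Context (A : vector_bundle M r).
Implicit Types (T : theta A) (S : {linear bisection A -> bisection A}).

Definition nijenhuis T S e1 e2 :=
  dorfman T (S e1) (S e2) - S (dorfman T (S e1) e2 + dorfman T e1 (S e2))
  + S (S (dorfman T e1 e2)).

(** Only additivity is asked, because a Dorfman bracket is not bilinear over smooth functions. *)
Definition biadditive T :=
  (forall e, {morph dorfman T^~ e : x y / x + y}) /\
  (forall e, {morph dorfman T e : x y / x + y}).

Lemma deform2E T S : biadditive T -> (forall e, S (S e) = - e) ->
  forall e1 e2, dorfman (deform (deform T S) S) e1 e2 =
    nijenhuis T S e1 e2 + nijenhuis T S e1 e2 - dorfman T e1 e2.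
Proof.
move=> [Dl Dr] SS e1 e2; rewrite /nijenhuis /= !SS.
rewrite (additive_opp (Dl e2)) (additive_opp (Dr e1)).
rewrite !(raddfD S) /= !(raddfN S) /= SS.
set a := dorfman T e1 e2; set b := dorfman T (S e1) (S e2).
set c := S _; set d := S _.
rewrite !opprD !opprK !addrA.
by rewrite [LHS](ACl (2*3*6*1*4*7*8*5*9)).
Qed.

(** With $S^2=-1$, replacing $e_1$ by $Se_1$ permutes the four terms of the torsion up to the factor
    $-S$. *)
Lemma nijenhuis_actl T S : biadditive T -> (forall e, S (S e) = - e) ->
  forall e1 e2, nijenhuis T S (S e1) e2 = - S (nijenhuis T S e1 e2).
Proof.
move=> [Dl Dr] SS e1 e2; rewrite /nijenhuis !SS.
rewrite (additive_opp (Dl _)) (additive_opp (Dl e2)).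
rewrite !(raddfD S) /= !(raddfN S) /=.
rewrite !opprD !opprK (raddfD S) /= !SS !addrA.
by rewrite [LHS](ACl (3*4*1*2)).
Qed.

Lemma nijenhuis_actr T S : biadditive T -> (forall e, S (S e) = - e) ->
  forall e1 e2, nijenhuis T S e1 (S e2) = - S (nijenhuis T S e1 e2).
Proof.
move=> [Dl Dr] SS e1 e2; rewrite /nijenhuis !SS.
rewrite (additive_opp (Dr _)) (additive_opp (Dr e1)).
rewrite !(raddfD S) /= !(raddfN S) /=.
rewrite !opprD !opprK (raddfD S) /= !SS !addrA.
by rewrite [LHS](ACl (2*1*4*3)).
Qed.

Lemma nijenhuis_biadditive T S : biadditive T ->
  (forall e, {morph (nijenhuis T S)^~ e : x y / x + y}) /\
  (forall e, {morph nijenhuis T S e : x y / x + y}).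
Proof.
move=> [Dl Dr]; split=> e x y; rewrite /nijenhuis !(raddfD S) /= !(Dl, Dr);
  by rewrite !(raddfD S) /= !opprD !addrA [LHS](ACl (1*3*5*7*2*4*6*8)).
Qed.

(** The anchor part is automatic from $S^2=-1$. On brackets, [deform2E] gives $2N-[\cdot,\cdot]$
    with $N$ the torsion, so the condition is $2N=0$. *)
Lemma deform2_eq_opp T S : biadditive T ->
    (forall e f, anchor T (- e) f = - anchor T e f) ->
    (forall e, S (S e) = - e) ->
  (deform (deform T S) S = theta_opp T <->
   forall e1 e2, nijenhuis T S e1 e2 = 0).
Proof.
move=> DT aN SS; split=> [E e1 e2|N0].
  apply: double_eq0; apply: (addIr (- dorfman T e1 e2)).
  by rewrite -deform2E // E add0r.
rewrite /theta_opp -[deform _ _]/(Theta _ _); congr Theta.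
  by apply/funext => e; apply/funext => f /=; rewrite SS aN.
apply/funext => e1; apply/funext => e2.
by rewrite -[LHS]/(dorfman (deform (deform T S) S) e1 e2) deform2E // N0 !add0r.
Qed.

End NijenhuisTorsion.

(** * Torsion of the endomorphism built from a 2-form and its inverse *)

Section Smap.
Context (R : realType) (n : nat) (M : manifold R n) (r : nat).
Context (A : vector_bundle M r) (mu : lie_algebroid A) (psi : trivector A).
Implicit Types (omega : form2 A) (X Y Z : section A) (pi : bivector A).
Implicit Types (al be : cosection A).

Let Theta := pre_courant_add (pre_courant_of_lie mu) (pre_courant_of_trivector psi).

Lemma trivectorDl al al' be : psi (al + al') be = psi al be + psi al' be.
Proof. by have := trivector_linearl psi be 1 al al'; rewrite !scale1r. Qed.

Lemma trivectorDr al be be' : psi al (be + be') = psi al be + psi al be'.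
Proof. by have := trivector_linearr psi al 1 be be'; rewrite !scale1r. Qed.

Lemma lrhoDl X Y f : lrho mu (X + Y) f = lrho mu X f + lrho mu Y f.
Proof. by have := lrho_linear mu 1 X Y f; rewrite scale1r mul1r. Qed.

Lemma lrho0l f : lrho mu 0 f = 0.
Proof. exact: additive_zero (fun X Y => lrhoDl X Y f). Qed.

Lemma lrho0r X : lrho mu X 0 = 0.
Proof. exact: lrho_cst. Qed.

Lemma lbr0l X : lbr mu 0 X = 0.
Proof. exact: additive_zero (fun Y Z => lbrDl mu Y Z X). Qed.

Lemma biadditive_lie_trivector : biadditive Theta.
Proof.
split=> -[Z ga] [X al] [Y be]; rewrite /=; congr pair; rewrite /=.
- by rewrite lbrDl trivectorDl opprD addrACA.
- apply: cosection_eq => W; rewrite !cosectionE /= /d1 /= lbrDl lrhoDl.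
  rewrite (raddfD ga) !lrhoD.
  by apply: cinfty_eq => x; rewrite !cinftyE; ring.
- by rewrite lbrDr trivectorDr opprD addrACA.
- apply: cosection_eq => W; rewrite !cosectionE /= /d1 /= lbrDl lrhoDl.
  rewrite !(raddfD ga) !lrhoD.
  by apply: cinfty_eq => x; rewrite !cinftyE; ring.
Qed.

Lemma dorfman_sections X Y : dorfman Theta (X, 0) (Y, 0) = (lbr mu X Y, 0).
Proof.
rewrite /=; congr pair => /=.
  by rewrite trivector_alt12 oppr0 addr0.
apply: cosection_eq => W; rewrite !cosectionE /= /d1 ?cosectionE.
rewrite !lrho0r.
by apply: cinfty_eq => x; rewrite !cinftyE; ring.
Qed.

Lemma dorfman_cosections al be :
  dorfman Theta (0, al) (0, be) = (- psi al be, 0).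
Proof.
rewrite /=; congr pair => /=; first by rewrite lbr_alt add0r.
apply: cosection_eq => W; rewrite !cosectionE /= /d1 ?cosectionE.
rewrite lbr0l !raddf0 !lrho0l !lrho0r.
by apply: cinfty_eq => x; rewrite !cinftyE; ring.
Qed.

Lemma dorfman_section_cosection X be :
  dorfman Theta (X, 0) (0, be) = (0, lie_deriv mu X be).
Proof.
rewrite /=; congr pair => /=.
  rewrite (additive_zero (fun a b => trivectorDl a b _)) oppr0 addr0.
  exact: additive_zero (lbrDr mu X).
apply: cosection_eq => W; rewrite !cosectionE /= /d1 ?cosectionE.
rewrite lrho0l lrho0r.
by apply: cinfty_eq => x; rewrite !cinftyE; ring.
Qed.

Lemma dorfman_cosection_section al Y :
  dorfman Theta (0, al) (Y, 0) = (0, - interior_d1 mu Y al).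
Proof.
rewrite /=; congr pair => /=.
  rewrite (additive_zero (trivectorDr _)) oppr0 addr0.
  exact: lbr0l.
apply: cosection_eq => W; rewrite !cosectionE /= /d1 ?cosectionE.
rewrite lrho0l.
by apply: cinfty_eq => x; rewrite !cinftyE; ring.
Qed.

(** Cartan calculus: $i_Yi_Xd\omega=L_Xi_Y\omega-i_Yd\,i_X\omega-i_{[X,Y]}\omega$. The first two
    terms are the mixed Dorfman brackets occurring in the torsion. *)
Lemma d2_lie_deriv omega X Y :
  contract_d2 mu omega X Y = lie_deriv mu X (flat omega Y)
    - interior_d1 mu Y (flat omega X) - flat omega (lbr mu X Y).
Proof.
apply: cosection_eq => Z; rewrite !cosectionE /= /d1 /d2 /=.
rewrite (form2_skew omega Y (lbr mu X Z)) (form2_skew omega X (lbr mu Y Z)).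
by apply: cinfty_eq => x; rewrite !cinftyE; ring.
Qed.

Lemma Smap_square omega pi : inverse_of pi omega ->
    (forall al, flat omega (sharp pi al) = al) ->
  forall e, Smap omega pi (Smap omega pi e) = - e.
Proof.
move=> piK omK [X al]; rewrite /Smap /= piK raddfN /= omK.
by rewrite -[RHS]/(- X, - al).
Qed.

(** The map [S] sends both sections into the dual, where [mu] brackets to zero and only [psi]
    remains; the other terms assemble into Cartan's formula after [sharp pi]. *)
Lemma nijenhuis_Smap_sections omega pi X Y : inverse_of pi omega ->
  nijenhuis Theta (Smap omega pi) (X, 0) (Y, 0) =
  (sharp pi (contract_d2 mu omega X Y) - psi (flat omega X) (flat omega Y), 0).
Proof.
pose S : {linear bisection A -> bisection A} := Smap omega pi.
move=> piK; rewrite /nijenhuis -/S.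
have SE Z : S (Z, 0) = (0, flat omega Z).
  by rewrite /S /= /Smap /= raddf0 oppr0.
have SE' al : S (0, al) = (- sharp pi al, 0).
  by rewrite /S /= /Smap /= raddf0.
rewrite !SE dorfman_cosections dorfman_cosection_section dorfman_section_cosection.
rewrite dorfman_sections [(0, _) + _](_ : _ =
  (0, lie_deriv mu X (flat omega Y) - interior_d1 mu Y (flat omega X))); last first.
  by rewrite addrC; congr pair; rewrite /= ?addr0.
rewrite !SE !SE' d2_lie_deriv !(raddfB (sharp pi)) /= piK.
congr pair => /=; last by rewrite subrr addr0.
by rewrite opprK -[LHS]addrA [LHS]addrC.
Qed.

Lemma nijenhuis_Smap_eq0 omega pi : inverse_of pi omega ->
    (forall al, flat omega (sharp pi al) = al) ->
  (forall e1 e2, nijenhuis Theta (Smap omega pi) e1 e2 = 0) <->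
  (forall X Y, sharp pi (contract_d2 mu omega X Y) =
     psi (flat omega X) (flat omega Y)).
Proof.
pose S : {linear bisection A -> bisection A} := Smap omega pi.
move=> piK omK; rewrite -/S; have SS : forall e, S (S e) = - e.
  exact: Smap_square.
split=> [N0 X Y|dE].
  have := N0 (X, 0) (Y, 0); rewrite nijenhuis_Smap_sections // => /(congr1 fst) /= /eqP.
  by rewrite subr_eq0 => /eqP.
(* Since the dual of $A$ is $S(A)$, antilinearity of the torsion reduces everything to pairs of
   sections of $A$. *)
have eE e : e = (e.1, 0) + S (sharp pi e.2, 0).
  case: e => X al; rewrite /S /= /Smap /= raddf0 omK oppr0.
  by congr pair; rewrite /= ?addr0 ?add0r.
have N00 X Y : nijenhuis Theta S (X, 0) (Y, 0) = 0.
  by rewrite nijenhuis_Smap_sections // dE subrr.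
have [NDl NDr] := nijenhuis_biadditive S biadditive_lie_trivector.
have Nl X e : nijenhuis Theta S (X, 0) e = 0.
  rewrite (eE e) NDr (nijenhuis_actr biadditive_lie_trivector SS) !N00.
  by rewrite raddf0 oppr0 addr0.
move=> e1 e2; rewrite (eE e1) NDl (nijenhuis_actl biadditive_lie_trivector SS).
by rewrite !Nl raddf0 oppr0 addr0.
Qed.

End Smap.

(** * Algebra of three invertible 2-forms indexed by $\mathbb{Z}_3$ *)

Section Triplet.
Context (R : realType) (n : nat) (M : manifold R n) (r : nat).
Context (A : vector_bundle M r) (omega : 'Z_3 -> form2 A) (pi : 'Z_3 -> bivector A).
Context (piK : forall i, inverse_of (pi i) (omega i)).
Context (omK : forall i al, flat (omega i) (sharp (pi i) al) = al).

(** This is $S_iS_j=-S_jS_i$ restricted to $A$; [flat_anticommuting] derives the half on the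
    dual. *)
Definition anticommuting := forall i j X, i != j ->
  sharp (pi i) (flat (omega j) X) = - sharp (pi j) (flat (omega i) X).

Lemma Z3_succ_cases (i j : 'Z_3) : i != j -> j = i + 1 \/ i = j + 1.
Proof.
case: i j => [[|[|[|//]]] ?] [[|[|[|//]]] ?] //=;
  by [left; apply/val_inj|right; apply/val_inj].
Qed.

(** The inverse of $N_i=\pi_{i-1}\omega_{i+1}$ is $\pi_{i+1}\omega_{i-1}$, so $N_i^2=-1$ reads
    $\pi_{i-1}\omega_{i+1}=-\pi_{i+1}\omega_{i-1}$. *)
Lemma transition_anticommuting :
  (forall i X, transition omega pi i (transition omega pi i X) = - X) <->
  anticommuting.
Proof.
split=> [NN|H i X]; last first.
  rewrite /transition [LHS]H ?omK ?piK //.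
  by case: i => [[|[|[|//]]] ?].
have step i X :
    sharp (pi i) (flat (omega (i + 1)) X) = - sharp (pi (i + 1)) (flat (omega i) X).
  (* Modulo 3, $N_{i-1}=\pi_{i+1}\omega_i$, which sends the chosen vector to $-X$. *)
  have := NN (i - 1) (- sharp (pi i) (flat (omega (i + 1)) X)).
  rewrite /transition.
  rewrite (_ : i - 1 - 1 = i + 1) ?subrK; last by case: i => [[|[|[|//]]] ?]; apply/val_inj.
  rewrite raddfN /= omK.
  rewrite (raddfN (sharp (pi (i + 1)))) /= piK opprK => <-.
  by rewrite !raddfN.
move=> i j X /Z3_succ_cases[->|->]; rewrite step //.
by rewrite opprK.
Qed.

Lemma flat_anticommuting : anticommuting -> forall i j al, i != j ->
  flat (omega i) (sharp (pi j) al) = - flat (omega j) (sharp (pi i) al).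
Proof.
by move=> H i j al nij; rewrite -{1}[al](omK i) H 1?eq_sym // raddfN /= omK.
Qed.

(** Two swaps whose signs cancel:
    $\omega_i\pi_{i-1}\omega_{i+1}=-\omega_i\pi_{i+1}\omega_{i-1}=\omega_{i+1}\pi_i\omega_{i-1}$,
    and the last term is $\omega_{i+1}N_{i+1}$. *)
Lemma flat_transition : anticommuting -> forall i j X,
  flat (omega i) (transition omega pi i X) = flat (omega j) (transition omega pi j X).
Proof.
move=> H; have step i X : flat (omega i) (transition omega pi i X) =
    flat (omega (i + 1)) (transition omega pi (i + 1) X).
  rewrite /transition addrK (_ : i + 1 + 1 = i - 1); last first.
    by case: i => [[|[|[|//]]] ?]; apply/val_inj.
  rewrite H; last by case: i => [[|[|[|//]]] ?].
  rewrite raddfN /= (flat_anticommuting H) ?opprK //.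
  by case: i => [[|[|[|//]]] ?].
move=> i j X; case: (eqVneq i j) => [->//|/Z3_succ_cases[->|->]].
  exact: step.
by rewrite -step.
Qed.

End Triplet.

(** * Equivalence of the two structures *)

Lemma anchor_opp (R : realType) n (M : manifold R n) r (A : vector_bundle M r)
    (T : pre_courant A) e f : anchor T (- e) f = - anchor T e f.
Proof.
have aD : {morph anchor T^~ f : x y / x + y}.
  move=> x y; have := anchor_linear (pre_courantP T) 1 x y f.
  by rewrite scale1r mul1r.
exact: additive_opp aD e.
Qed.

Theorem proposition9p3 (R : realType) (n r : nat) (M : manifold R n)
    (A : vector_bundle M r) (mu : lie_algebroid A)
    (omega : 'Z_3 -> form2 A) (pi : 'Z_3 -> bivector A) :
  (hypersymplectic_torsion mu omega /\
     forall i, inverse_of (pi i) (omega i)) <->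
  (exists psi : trivector A,
     hypersymplectic
       (pre_courant_add (pre_courant_of_lie mu) (pre_courant_of_trivector psi))
       (fun i => Smap (omega i) (pi i))).
Proof.
split=> [[[nd [pi' [piK' NN dN]]] piK]|[psi [_ SS SA dS]]].
- have omK i al : flat (omega i) (sharp (pi i) al) = al.
    by have [g _ gK] := nd i; rewrite -[al]gK piK.
  (* The torsion structure comes with its own inverses [pi']; uniqueness of inverses transfers its
     conditions to the given [pi]. *)
  have NE i X : transition omega pi' i X = transition omega pi i X.
    by rewrite /transition -[flat _ X](omK (i - 1)) piK' piK.
  have {}NN i X : transition omega pi i (transition omega pi i X) = - X.
    by rewrite -!NE NN.
  have {}dN i j X Y Z : let N := transition omega pi in
      d2 mu (omega i) (N i X) (N i Y) (N i Z) =
      d2 mu (omega j) (N j X) (N j Y) (N j Z).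
    by have := dN i j X Y Z; rewrite /= !NE.
  have H := proj1 (transition_anticommuting piK omK) NN.
  have HF := flat_anticommuting omK H.
  (* The index 0, which stands for 3, is an arbitrary choice: equality of the $N_id\omega_i$ makes
     this trivector serve every index. *)
  exists (torsion_trivector mu (omega 0) (pi 0)); split.
  + move=> i [X al] [Y be]; rewrite /pairing /= raddfN /= [be _]sharp_skew.
    rewrite (form2_skew _ X Y) !raddfN /=.
    by apply: cinfty_eq => x; rewrite !cinftyE; ring.
  + by move=> i e; exact: Smap_square.
  + move=> i j [X al] nij; rewrite /= /Smap /=; congr pair => /=.
      by rewrite H // opprK.
    by rewrite !raddfN /= HF.
  + move=> i; apply/(deform2_eq_opp (biadditive_lie_trivector _ _)).
    * exact: anchor_opp.
    * exact: Smap_square.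
    apply/nijenhuis_Smap_eq0 => // X Y /=.
    (* Comparing after $\omega_i$ leaves
       $d\omega_i(X,Y,Z)=d\omega_0(\pi_0\omega_iX,\pi_0\omega_iY,\pi_0\omega_iZ)$; the sign from
       skewness of [pi 0] cancels that of [omega i]. *)
    rewrite -[LHS](piK i) -[RHS](piK i); congr (sharp _ _).
    rewrite omK; apply: cosection_eq => Z /=; rewrite form2_skew.
    rewrite -[RHS]/(- flat (omega i) Z (sharp (pi 0) _)) sharp_skew opprK /=.
    have NX W : W = transition omega pi i (- transition omega pi i W).
      have -> : transition omega pi i (- transition omega pi i W) =
          - transition omega pi i (transition omega pi i W).
        by rewrite {1}/transition !raddfN.
      by rewrite NN opprK.
    (* From $\omega_iN_i=\omega_0N_0$ follows $\pi_0\omega_i=N_0N_i^{-1}$ with $N_i^{-1}=-N_i$, so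
       [dN] applies at the vectors $-N_iW$. *)
    have N0 W : sharp (pi 0) (flat (omega i) W) =
        transition omega pi 0 (- transition omega pi i W).
      by rewrite {1}[W]NX (flat_transition omK H i 0) piK.
    by rewrite !N0 (dN 0 i) -!NX.
(* The two diagonal blocks of $S_i^2=-1$ say that $\pi_i$ and $\omega_i$ are mutually inverse. *)
- have piK i : inverse_of (pi i) (omega i).
    by move=> X; apply/oppr_inj; have /(congr1 fst) := SS i (X, 0).
  have omK i al : flat (omega i) (sharp (pi i) al) = al.
    by apply/oppr_inj; have /(congr1 snd) := SS i (0, al); rewrite /= raddfN.
  have H : anticommuting omega pi.
    move=> i j X nij; apply/oppr_inj.
    by have /(congr1 fst) := SA i j (X, 0) nij.
  split=> //; split.
    by move=> i; exists (sharp (pi i)); [exact: piK|exact: omK].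
  exists pi; split=> //; first exact/transition_anticommuting.
  have dE i X Y Z : d2 mu (omega i) X Y Z =
      - flat (omega i) Z (psi (flat (omega i) X) (flat (omega i) Y)).
    have N0 := proj1 (deform2_eq_opp (biadditive_lie_trivector _ _)
      (anchor_opp _) (SS i)) (dS i).
    have dE := proj1 (nijenhuis_Smap_eq0 mu psi (piK i) (omK i)) N0 X Y.
    rewrite -[LHS]/(contract_d2 mu (omega i) X Y Z) -(omK i (contract_d2 _ _ _ _)).
    by rewrite dE /= form2_skew.
  (* By [dE], each side depends on its transition map only through $\omega_iN_i$, which is the same
     for all indices. *)
  move=> i j X Y Z N; rewrite !dE.
  by rewrite !(flat_transition omK H i j).
Qed.
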